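(* Given any $\alpha>2$, there exist a non-trivial complex Banach space $X_\alpha$ and a power-bounded operator $T\in\mathcal{B}(X_\alpha)$ such that $\sigma(T)\cap\mathbb{T}=\{1\}$, $\|R(\mathrm{e}^{\mathrm{i}\theta},T)\|=O(|\theta|^{-\alpha})$ as $\theta\to0$, and $$\limsup_{n\to\infty}\|T^n(I-T)\|\left(\frac{n}{\log n}\right)^{1/\alpha}>0.$$
   Context: $T$ is power-bounded if $\sup_{n\geq0}\|T^n\|<\infty$; $\mathbb{T}$ is the unit circle; $R(\lambda,T)=(\lambda-T)^{-1}$. *)

(* Defs.v *)
From HB Require Import structures.
From mathcomp Require Import all_boot all_order all_algebra.
From mathcomp Require Import all_classical all_reals all_analysis.
From mathcomp Require Import complex.
Import Order.TTheory GRing.Theory Num.Theory.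
Import numFieldNormedType.Exports.
Local Open Scope classical_set_scope.
Local Open Scope ring_scope.

(* Operator norm of a map A : X -> X on a complex normed space X
   (norms are C-valued in MathComp-Analysis and real-valued in fact;
   we take their real part).  Only applied to bounded linear maps. *)
Definition opnorm {R : realType} {X : normedModType R[i]} (A : X -> X) : R :=
  sup [set complex.Re `|A x| | x in [set x : X | `|x| <= 1]].

Definition resolvent_inverse {R : realType} {X : normedModType R[i]}
  (T : X -> X) (lambda : R[i]) (S : X -> X) : Prop :=
  continuous S /\ (forall x, S (lambda *: x - T x) = x)
              /\ (forall x, lambda *: S x - T (S x) = x).

Definition spectrum {R : realType} {X : normedModType R[i]} (T : X -> X) : set R[i] :=
  [set lambda | ~ exists S, resolvent_inverse T lambda S].

Definition unit_circle {R : realType} : set R[i] := [set z | `|z| = 1].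

Definition expi {R : realType} (theta : R) : R[i] := (cos theta +i* sin theta)%C.

(* Main.v *)
Require Import Defs.
From HB Require Import structures.
From mathcomp Require Import all_boot all_order all_algebra.
From mathcomp Require Import all_classical all_reals all_analysis.
From mathcomp Require Import complex ring lra zify.
Import Order.TTheory GRing.Theory Num.Theory.
Import numFieldNormedType.Exports.
Local Open Scope classical_set_scope.
Local Open Scope ring_scope.

(** The space is an [l^oo]-sum of finite blocks. Block [k] has norm
    [sup_M (|x_M| + d * sum_{m < M} |x_m| (1 + d)^m)] with [d = k^-4]. The left
    shift [S] is a contraction for it; its resolvent on the unit circle is
    [O(1/d)], because the weighted [l^1] part dominates [sum |x_m|], whereas
    [S^n] still has norm of order one up to [n] about [log(1/d)/d]: a vector
    supported near position [n] pays [d (1 + d)^n] for the weighted sum.  On block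
    [k] the operator is [u ((1 - e) + e S)], with [|u| = 1], [|u - 1| = e] and
    [e^(alpha - 1)] comparable to [d].  Its spectrum sits in a disc of radius [e]
    around [u (1 - e)], so that its resolvent is [O(1/(e d)) = O(e^-alpha)] at
    distance [e] from [u] and [O(1/|z - u|)] farther away, which gives the bound
    [O(|z - 1|^-alpha)] uniformly in [k].  The power [n] of the average is a
    binomial mean of powers of [S] around [e n], with fluctuations much smaller
    than [1/d]; hence [T^n (1 - T)] has norm at least of order [e] when [e n] is about
    [log(1/d)/d], that is, when [e^-1] is about [(n / log n)^(1/alpha)]. *)

(** * Real-valued modulus of complex numbers *)

Section Modulus.
Context {R : realType}.
Implicit Types z w : R[i].

Definition cabs z : R := complex.Re `|z|.

Lemma normCE z : `|z| = (cabs z)%:C%C.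
Proof. by case: z. Qed.

Lemma cabsE z : cabs z = Num.sqrt (complex.Re z ^+ 2 + complex.Im z ^+ 2).
Proof. by case: z. Qed.

Lemma cabs_ge0 z : 0 <= cabs z.
Proof. by rewrite cabsE sqrtr_ge0. Qed.

Lemma cabsM z w : cabs (z * w) = cabs z * cabs w.
Proof. by apply: complexI; rewrite -normCE normrM !normCE rmorphM. Qed.

Lemma cabsD z w : cabs (z + w) <= cabs z + cabs w.
Proof. by rewrite -lecR rmorphD /= -!normCE ler_normD. Qed.

Lemma cabs0 : cabs 0 = 0.
Proof. by rewrite /cabs normr0. Qed.

Lemma cabs1 : cabs 1 = 1.
Proof. by rewrite /cabs normr1. Qed.

Lemma cabsN z : cabs (- z) = cabs z.
Proof. by rewrite /cabs normrN. Qed.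

Lemma cabsB z w : cabs (z - w) <= cabs z + cabs w.
Proof. by rewrite -(cabsN w) cabsD. Qed.

Lemma cabs_dist z w : cabs z - cabs w <= cabs (z - w).
Proof. by have := cabsD (z - w) w; rewrite subrK; lra. Qed.

Lemma cabs_eq0 z : cabs z = 0 -> z = 0.
Proof. by move=> z0; apply/normr0_eq0; rewrite normCE z0. Qed.

Lemma cabs_real (r : R) : cabs r%:C%C = `|r|.
Proof. by rewrite cabsE /= expr0n addr0 sqrtr_sqr. Qed.

Lemma cabs_ge_Re z : `|complex.Re z| <= cabs z.
Proof. by rewrite cabsE -sqrtr_sqr ler_wsqrtr // lerDl sqr_ge0. Qed.

Lemma cabs_ge_Im z : `|complex.Im z| <= cabs z.
Proof. by rewrite cabsE -sqrtr_sqr ler_wsqrtr // lerDr sqr_ge0. Qed.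

Lemma cabs_le z : cabs z <= `|complex.Re z| + `|complex.Im z|.
Proof.
have cabsi : cabs ('i%C : R[i]) = 1 by rewrite cabsE /= expr0n expr1n add0r sqrtr1.
rewrite [in leLHS](complexE z); apply: le_trans (cabsD _ _) _.
by rewrite cabsM cabsi mul1r !cabs_real.
Qed.

End Modulus.

(** * The norm of one block and its resolvent estimates *)

Section Block.
Context {R : realType}.
Implicit Types (d : R) (x y : nat -> R[i]).

(** The norm of a block is the supremum over all [M]; past the end of the block [x M] is 0 and only
    the full weighted sum remains. *)
Definition blockn d x (M : nat) : R :=
  cabs (x M) + d * \sum_(m < M) cabs (x m) * (1 + d) ^+ m.

Lemma blockn_ge0 d x M : 0 <= d -> 0 <= blockn d x M.
Proof.
move=> d0; rewrite addr_ge0 ?cabs_ge0 // mulr_ge0 // sumr_ge0 // => m _.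
by rewrite mulr_ge0 ?cabs_ge0 // exprn_ge0 // addr_ge0.
Qed.

Lemma cabs_le_blockn d x M : 0 <= d -> cabs (x M) <= blockn d x M.
Proof.
move=> d0; rewrite lerDl mulr_ge0 // sumr_ge0 // => m _.
by rewrite mulr_ge0 ?cabs_ge0 // exprn_ge0 // addr_ge0.
Qed.

Lemma sum_le_blockn d x M :
  d * \sum_(m < M) cabs (x m) * (1 + d) ^+ m <= blockn d x M.
Proof. by rewrite lerDr cabs_ge0. Qed.

Lemma blocknD d x y M : 0 <= d ->
  blockn d (fun m => x m + y m) M <= blockn d x M + blockn d y M.
Proof.
move=> d0; rewrite /blockn addrACA lerD ?cabsD // -mulrDr ler_wpM2l //.
rewrite -big_split /=; apply: ler_sum => m _.
by rewrite -mulrDl ler_wpM2r ?cabsD // exprn_ge0 // addr_ge0.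
Qed.

Lemma blocknZ d c x M : blockn d (fun m => c * x m) M = cabs c * blockn d x M.
Proof.
rewrite /blockn cabsM mulrDr; congr (_ + _).
rewrite mulrCA; congr (_ * _); rewrite mulr_sumr.
by apply: eq_bigr => m _; rewrite cabsM mulrA.
Qed.

(** The weights [(1 + d) ^+ m] increase with [m], so moving every entry one place down can only
    lower the weighted sum. *)
Lemma blockn_shift d x M : 0 <= d ->
  blockn d (fun m => x m.+1) M <= blockn d x M.+1.
Proof.
move=> d0; rewrite /blockn lerD2l ler_wpM2l // big_ord_recl /=.
apply: ler_wpDl; first by rewrite mulr_ge0 ?cabs_ge0.
apply: ler_sum => m _; rewrite ler_wpM2l ?cabs_ge0 //.
by rewrite /bump /= add1n exprS ler_peMl ?lerDl // exprn_ge0 // addr_ge0.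
Qed.

(* The recursion [|a| P M <= B + eta P M.+1] for [P = blockn d y] is run
   backwards from the end of the block, where [P] is constant. *)
Lemma blockn_far d (a : R[i]) (eta B : R) x y (n M : nat) :
  0 <= d -> 0 <= eta -> eta < cabs a ->
  (forall m, x m = a * y m - eta%:C%C * y m.+1) ->
  (forall m, (n <= m)%N -> y m = 0) ->
  (forall m, blockn d x m <= B) ->
  blockn d y M <= B / (cabs a - eta).
Proof.
move=> d0 eta0 etaa xE y0 xB.
have ha : 0 < cabs a - eta by rewrite subr_gt0.
have rec m : cabs a * blockn d y m <= B + eta * blockn d y m.+1.
  rewrite -blocknZ.
  have -> : (fun m => a * y m) = (fun m => x m + eta%:C%C * y m.+1).
    by apply/funext => i; rewrite xE subrK.
  apply: le_trans (blocknD _ _ _ _ d0) _; rewrite lerD //.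
  rewrite (blocknZ d _ (fun m => y m.+1)) cabs_real ger0_norm // ler_wpM2l //.
  exact: blockn_shift.
suff H j : forall m, (n <= m + j)%N -> blockn d y m <= B / (cabs a - eta).
  by apply: (H n); rewrite leq_addl.
elim: j => [|j IH] m nm.
  rewrite addn0 in nm; rewrite ler_pdivlMr //; have := rec m.
  have -> : blockn d y m.+1 = blockn d y m.
    rewrite /blockn big_ord_recr /= (y0 m) // (y0 m.+1) ?(leq_trans nm) //.
    by rewrite cabs0 mul0r addr0.
  by lra.
have IHm := IH m.+1 _; rewrite -(ler_pM2l (lt_le_trans (le_lt_trans eta0 etaa) (lexx _))).
apply: le_trans (rec m) _.
rewrite (_ : cabs a * _ = B + eta * (B / (cabs a - eta))).
  by rewrite lerD2l ler_wpM2l // IHm // addSnnS.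
by field; rewrite lt0r_neq0.
Qed.

(** Here [cabs a] may equal [eta], so the backward recursion has no geometric gain. The two parts of
    the norm are estimated separately from the weighted [l^1] part of [x], at the cost of a factor
    [1 / d]. *)
Lemma blockn_near d (a : R[i]) (eta B : R) x y (n M : nat) :
  0 < d -> 0 < eta -> eta <= cabs a ->
  (forall m, x m = a * y m - eta%:C%C * y m.+1) ->
  (forall m, (n <= m)%N -> y m = 0) ->
  (forall m, blockn d x m <= B) ->
  blockn d y M <= (2 + d) / (eta * d) * B.
Proof.
move=> d0 eta0 etaa xE y0 xB.
have d1 m : 0 <= (1 + d) ^+ m by rewrite exprn_ge0 // addr_ge0 // ltW.
have rec m : eta * cabs (y m) <= cabs (x m) + eta * cabs (y m.+1).
  have : cabs a * cabs (y m) <= cabs (x m) + eta * cabs (y m.+1).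
    have -> : cabs a * cabs (y m) = cabs (x m + eta%:C%C * y m.+1).
      by rewrite -cabsM xE subrK.
    by rewrite (le_trans (cabsD _ _)) // cabsM cabs_real (gtr0_norm eta0).
  by apply: le_trans; rewrite ler_wpM2r ?cabs_ge0.
(* Iterating [rec] to the end of the block leaves a sum of terms [cabs (x i)]; since all weights are
   at least 1, it is at most [B / d]. *)
have sup_le m : eta * cabs (y m) <= B / d.
  have tele j : forall m, (n <= m + j)%N ->
      eta * cabs (y m) <= \sum_(i < j) cabs (x (m + i)%N).
    elim: j => [|j IH] i nm.
      by rewrite addn0 in nm; rewrite big_ord0 y0 // cabs0 mulr0.
    rewrite big_ord_recl addn0 (le_trans (rec i)) // lerD2l.
    rewrite (le_trans (IH i.+1 _)) ?addSnnS //.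
    by apply: ler_sum => k _; rewrite addSnnS.
  rewrite (le_trans (tele n m _)) ?leq_addl // ler_pdivlMr // mulrC.
  apply: le_trans (xB (m + n)%N); apply: le_trans (sum_le_blockn _ _ _).
  rewrite ler_pM2l // big_split_ord /=; apply: ler_wpDl.
    by apply: sumr_ge0 => i _; rewrite mulr_ge0 ?cabs_ge0.
  apply: ler_sum => i _; rewrite ler_peMr ?cabs_ge0 //.
  by rewrite exprn_ege1 // lerDl ltW.
(* [N] reaches past both [M] and the support of [y], so [Y] is the full weighted sum. *)
pose N := maxn M n.
pose Y := \sum_(m < N) cabs (y m) * (1 + d) ^+ m.
(* Shifting divides the weighted sum by at least [1 + d]; this gain lets the shifted term be
   absorbed into [eta * Y]. *)
have sum_le : eta * Y * d <= B / d * (1 + d).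
  have shiftY : (1 + d) * \sum_(m < N) cabs (y m.+1) * (1 + d) ^+ m <= Y.
    have -> : Y = \sum_(m < N.+1) cabs (y m) * (1 + d) ^+ m.
      by rewrite big_ord_recr /= y0 ?leq_maxr // cabs0 mul0r addr0.
    rewrite big_ord_recl mulr_sumr; apply: ler_wpDl.
      by rewrite mulr_ge0 ?cabs_ge0.
    by apply: ler_sum => m _; rewrite mulrCA -exprS.
  have recY : eta * Y <= B / d + eta * \sum_(m < N) cabs (y m.+1) * (1 + d) ^+ m.
    have xsum : \sum_(m < N) cabs (x m) * (1 + d) ^+ m <= B / d.
      by rewrite ler_pdivlMr // mulrC (le_trans (sum_le_blockn _ _ _)).
    apply: le_trans (lerD xsum (lexx _)).
    rewrite !mulr_sumr -big_split /=; apply: ler_sum => m _.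
    by rewrite !mulrA -mulrDl ler_wpM2r.
  move: shiftY recY; set Z := \sum_(m < N) _ => shiftY recY.
  have : (1 + d) * (eta * Y) <= (1 + d) * (B / d + eta * Z).
    by rewrite ler_wpM2l // addr_ge0 // ltW.
  have : eta * ((1 + d) * Z) <= eta * Y by rewrite ler_pM2l.
  by rewrite !mulrDr !mulrDl !mul1r !mulr1; lra.
rewrite mulrAC ler_pdivlMr ?mulr_gt0 // /blockn.
have Yge : \sum_(m < M) cabs (y m) * (1 + d) ^+ m <= Y.
  rewrite /Y (big_ord_widen N (fun m => cabs (y m) * (1 + d) ^+ m)) ?leq_maxl //.
  rewrite [leRHS](bigID (fun i : 'I_N => (i < M)%N)) /= lerDl.
  by apply: sumr_ge0 => i _; rewrite mulr_ge0 ?cabs_ge0.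
have : eta * d * d * \sum_(m < M) cabs (y m) * (1 + d) ^+ m <= eta * d * d * Y.
  by rewrite ler_pM2l // !mulr_gt0.
have : eta * cabs (y M) * d <= B.
  by have := sup_le M; rewrite ler_pdivlMr.
have : eta * Y * d * d <= B * (1 + d).
  have -> : B * (1 + d) = B / d * (1 + d) * d by field; rewrite gt_eqF.
  by rewrite ler_pM2r.
by lra.
Qed.

End Block.

(** * The bounded sum of the blocks as a normed space *)

Section BlockSpace.
Context (R : realType) (del : nat -> {nonneg R}) (len : nat -> nat).
Local Notation d k := ((del k)%:num).

Definition bounded_blocks (x : nat -> nat -> R[i]) :=
  exists B : R, forall k M, blockn (d k) (x k) M <= B.

Definition block_mem : {pred nat -> nat -> R[i]} := fun x =>
  `[< bounded_blocks x /\ forall k m, (len k <= m)%N -> x k m = 0 >].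

Lemma block_memP x :
  reflect (bounded_blocks x /\ forall k m, (len k <= m)%N -> x k m = 0)
          (x \in block_mem).
Proof. exact: asboolP. Qed.

Lemma block_mem_submod : submod_closed block_mem.
Proof.
split.
  apply/block_memP; split=> //; exists 0 => k M.
  by rewrite /blockn big1 => [|i _]; rewrite /= ?cabs0 ?mul0r // mulr0 addr0.
move=> c x y /block_memP[[B xB] x0] /block_memP[[B' yB] y0].
apply/block_memP; split=> [|k m km]; last first.
  by rewrite (_ : _ k m = c * x k m + y k m) // x0 // y0 // mulr0 addr0.
exists (cabs c * B + B') => k M.
apply: le_trans (blocknD _ (fun m => c * x k m) (y k) _ _) _ => //.
by rewrite blocknZ lerD // ler_wpM2l ?cabs_ge0.
Qed.

HB.instance Definition _ :=
  GRing.isSubmodClosed.Build _ _ block_mem block_mem_submod.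

Record blockseq := BlockSeq { entry :> nat -> nat -> R[i]; _ : entry \in block_mem }.

HB.instance Definition _ := [isSub for entry].
HB.instance Definition _ := [Choice of blockseq by <:].
HB.instance Definition _ := [SubChoice_isSubLmodule of blockseq by <:].

Definition block_values (x : blockseq) : set R :=
  [set blockn (d km.1) (x km.1) km.2 | km in [set: nat * nat]].

Definition block_norm (x : blockseq) : R := sup (block_values x).

Lemma entry_ge_len (x : blockseq) k m : (len k <= m)%N -> x k m = 0.
Proof. by have /block_memP[_] := valP x; apply. Qed.

Lemma blockn_le_norm (x : blockseq) k M : blockn (d k) (x k) M <= block_norm x.
Proof.
apply: ub_le_sup; last by exists (k, M).
by have /block_memP[[B xB] _] := valP x; exists B => _ [[i m] _ <-] /=.
Qed.

Lemma block_norm_le (x : blockseq) B :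
  (forall k M, blockn (d k) (x k) M <= B) -> block_norm x <= B.
Proof.
move=> xB; apply: ge_sup => [|_ [[k m] _ <-] //=].
by exists (blockn (d 0%N) (x 0%N) 0); exists (0%N, 0%N).
Qed.

Lemma block_norm_ge0 x : 0 <= block_norm x.
Proof. exact: le_trans (blockn_ge0 _ _ _ _) (blockn_le_norm x 0 0). Qed.

Lemma cabs_le_norm (x : blockseq) k m : cabs (x k m) <= block_norm x.
Proof. exact: le_trans (cabs_le_blockn _ _ _ _) (blockn_le_norm x k m). Qed.

Lemma blockseq_ext (x y : blockseq) : (forall k m, x k m = y k m) -> x = y.
Proof. by move=> xy; apply/val_inj/funext => k; apply/funext. Qed.

Lemma entryD (x y : blockseq) k m : (x + y) k m = x k m + y k m.
Proof. by []. Qed.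

Lemma entryZ c (x : blockseq) k m : (c *: x) k m = c * x k m.
Proof. by []. Qed.

Lemma entryB (x y : blockseq) k m : (x - y) k m = x k m - y k m.
Proof. by []. Qed.

Let normC (x : blockseq) : R[i] := (block_norm x)%:C%C.

Let normCD x y : normC (x + y) <= normC x + normC y.
Proof.
rewrite /normC -rmorphD lecR; apply: block_norm_le => k M.
apply: le_trans (blocknD _ (x k) (y k) _ _) _ => //.
by rewrite lerD // blockn_le_norm.
Qed.

Let normC0_eq0 x : normC x = 0 -> x = 0.
Proof.
move=> [x0]; apply: blockseq_ext => k m; apply: cabs_eq0.
by apply/eqP; rewrite eq_le cabs_ge0 andbT -x0 cabs_le_norm.
Qed.

Let block_normZ_le c x : block_norm (c *: x) <= cabs c * block_norm x.
Proof.
apply: block_norm_le => k M; rewrite (blocknZ (d k) c (x k)).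
by rewrite ler_wpM2l ?cabs_ge0 // blockn_le_norm.
Qed.

Let normCZ c x : normC (c *: x) = `|c| * normC x.
Proof.
rewrite normCE /normC -rmorphM; congr (_%:C)%C; apply/eqP.
rewrite eq_le block_normZ_le andTb.
have [->|c0] := eqVneq c 0; first by rewrite cabs0 mul0r block_norm_ge0.
have cc : 0 < cabs c.
  by rewrite lt_neqAle cabs_ge0 andbT; apply: contra c0 => /eqP/esym/cabs_eq0 ->.
(* The reverse inequality is [block_normZ_le] for the scalar [c^-1]. *)
rewrite -ler_pdivlMl // (_ : _^-1 = cabs c^-1); last first.
  by apply: (mulfI (lt0r_neq0 cc)); rewrite divff ?gt_eqF // -cabsM divff // cabs1.
by rewrite -{1}(scalerK c0 x) block_normZ_le.
Qed.

HB.instance Definition _ :=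
  Lmodule_isNormed.Build R[i] blockseq normCD normCZ normC0_eq0.

Lemma block_normE (x : blockseq) : `|x| = (block_norm x)%:C%C.
Proof. by []. Qed.

End BlockSpace.

(** * Completeness of the space of blocks *)

Section Completeness.
Context (R : realType) (del : nat -> {nonneg R}) (len : nat -> nat).
Local Notation X := (blockseq R del len).
Local Notation d k := ((del k)%:num).

Lemma gt0_complexE (e : R[i]) : 0 < e -> 0 < complex.Re e /\ e = (complex.Re e)%:C%C.
Proof. by case: e => a b; rewrite ltcE /= => /andP[/eqP -> ?]. Qed.

(** Each [blockn] sees finitely many entries, so the norm bounds of a Cauchy filter pass to its
    entrywise limit, uniformly in the block. *)
Lemma blockseq_complete (F : set_system X) : ProperFilter F -> cauchy F -> cvg F.
Proof.
move=> FF /cauchyP Fc.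
have {}Fc (e : R) : 0 < e ->
    exists x0 : X, \forall x \near F, block_norm _ _ _ (x0 - (x : X)) < e.
  move=> e0; have [|x0 Fx0] := Fc e%:C%C; first by rewrite ltcR.
  exists x0; apply: filterS Fx0 => x; rewrite -ball_normE /ball_ /=.
  by rewrite block_normE ltcR.
(* Used for the real and imaginary parts, both 1-Lipschitz, to reduce to completeness of [R]. *)
have entry_cvg (f : R[i] -> R) k m : (forall z w, `|f z - f w| <= cabs (z - w)) ->
    exists l : R, f ((x : X) k m) @[x --> F] --> l.
  move=> f1; apply/cvg_ex; apply: R_complete; apply/cauchy_exP => e e0.
  have [x0 Fx0] := Fc e e0; exists (f (x0 k m)).
  apply: filterS Fx0 => x; rewrite -ball_normE /ball_ /=; apply: le_lt_trans.
  apply: le_trans (f1 _ _) _; rewrite -[x0 k m - x k m]entryB; exact: cabs_le_norm.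
have /choice[y yP] : forall km : nat * nat, exists z : R[i],
    forall t, 0 < t -> \forall x \near F, cabs ((x : X) km.1 km.2 - z) < t.
  move=> [k m]; have [z w|a xa] := entry_cvg (@complex.Re R) k m.
    by rewrite -raddfB /= cabs_ge_Re.
  have [z w|b xb] := entry_cvg (@complex.Im R) k m.
    by rewrite -raddfB /= cabs_ge_Im.
  exists (a +i* b)%C => t t0; have t2 : 0 < t / 2 by rewrite divr_gt0.
  move/cvgrPdist_lt : xa => /(_ _ t2) xa; move/cvgrPdist_lt : xb => /(_ _ t2) xb.
  apply: filterS2 xa xb => x xa xb; apply: le_lt_trans (cabs_le _) _.
  move: xa xb; rewrite (distrC a) (distrC b) /=.
  by case: (x k m) => p q /=; lra.
pose z k m := y (k, m).
have zP k m t : 0 < t -> \forall x \near F, cabs ((x : X) k m - z k m) < t.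
  exact: (yP (k, m)).
have sumP k M : forall t, 0 < t -> \forall x \near F,
    \sum_(m < M) cabs ((x : X) k m - z k m) * (1 + d k) ^+ m < t.
  elim: M => [|M IH] t t0; first by near=> x; rewrite big_ord0.
  have t2 : 0 < t / 2 by rewrite divr_gt0.
  have d1 : 0 < (1 + d k) ^+ M by rewrite exprn_gt0 // ltr_pwDl.
  have := zP k M _ (divr_gt0 t2 d1); apply: filterS2 (IH _ t2) => x xM.
  by rewrite ltr_pdivlMr // big_ord_recr /=; move: xM; lra.
have blockP k M t : 0 < t -> \forall x \near F,
    blockn (d k) (fun m => (x : X) k m - z k m) M < t.
  move=> t0; have t2 : 0 < t / 2 by rewrite divr_gt0.
  have d1 : 0 < 1 + d k by rewrite ltr_pwDl.
  have := sumP k M _ (divr_gt0 t2 d1); apply: filterS2 (zP k M _ t2) => x xM.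
  rewrite ltr_pdivlMr // /blockn; set S := \sum_(m < M) _ => S_lt.
  have S0 : 0 <= S.
    by apply: sumr_ge0 => m _; rewrite mulr_ge0 ?cabs_ge0 // exprn_ge0 // ltW.
  by move: xM S_lt; lra.
(* How near [x] must be may depend on [k], [M] and [t], but the bound [e] does not; hence entrywise
   convergence suffices. *)
have limP (x0 : X) e : (\forall x \near F, block_norm _ _ _ (x0 - (x : X)) < e) ->
    forall k M, blockn (d k) (fun m => x0 k m - z k m) M <= e.
  move=> Fx0 k M; apply/ler_addgt0Pr => t t0.
  have [x [x1 x2]] := filter_ex (filterI Fx0 (blockP k M t t0)).
  have -> : (fun m => x0 k m - z k m) =
      (fun m => (x0 - x) k m + (x k m - z k m)).
    by apply/funext => m; rewrite entryB addrA subrK.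
  apply: le_trans (blocknD _ _ _ _ _) _ => //; rewrite lerD // ?(ltW x2) //.
  exact: le_trans (blockn_le_norm _ _ _ _ _ _) (ltW x1).
have zX : z \in block_mem R del len.
  apply/block_memP; split=> [|k m km]; last first.
    apply: cabs_eq0; apply/eqP; rewrite eq_le cabs_ge0 andbT.
    apply/ler_addgt0Pr => t /(zP k m)/filter_ex[x].
    by rewrite entry_ge_len // sub0r cabsN add0r => /ltW.
  have [x0 Fx0] := Fc 1 ltr01; exists (block_norm _ _ _ x0 + 1) => k M.
  have -> : z k = (fun m => x0 k m + -1 * (x0 k m - z k m)).
    by apply/funext => m; rewrite mulN1r opprB addrC subrK.
  apply: le_trans (blocknD _ _ _ _ _) _ => //.
  rewrite blocknZ cabsN cabs1 mul1r lerD ?blockn_le_norm //.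
  exact: limP.
apply/cvg_ex; exists (BlockSeq _ _ _ z zX); apply/fcvgrPdist_lt => e /gt0_complexE[e0 ->].
have e2 : 0 < complex.Re e / 2 by rewrite divr_gt0.
have [x0 Fx0] := Fc _ e2; apply: filterS (Fx0) => x xe.
rewrite block_normE ltcR; set w := BlockSeq _ _ _ _ _.
have -> : w - x = (x0 - x) - (x0 - w) by rewrite opprB [RHS]addrC addrA subrK.
rewrite -ltcR -block_normE; apply: le_lt_trans (ler_normB _ _) _.
rewrite !block_normE -rmorphD ltcR.
have : block_norm _ _ _ (x0 - w) <= complex.Re e / 2.
  by apply: block_norm_le => k M; exact: limP.
by move: xe; lra.
Unshelve. all: by end_near. Qed.

HB.instance Definition _ := Uniform_isComplete.Build X blockseq_complete.

End Completeness.

(** * Operator norms, and resolvents from lower bounds *)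

Section OperatorNorm.
Context {R : realType} {X : normedModType R[i]}.
Implicit Types A : X -> X.

Lemma Re_norm_ge0 (x : X) : 0 <= complex.Re `|x|.
Proof. by have := normr_ge0 x; rewrite lecE /= => /andP[]. Qed.

Lemma norm_ReE (x : X) : `|x| = (complex.Re `|x|)%:C%C.
Proof.
have := normr_ge0 x; rewrite lecE /= => /andP[/eqP + _].
by case: (`|x|) => a b /= ->.
Qed.

Lemma opnorm_le A C :
  (forall x : X, complex.Re `|x| <= 1 -> complex.Re `|A x| <= C) -> opnorm A <= C.
Proof.
move=> AC; apply: ge_sup => [|_ [x /= x1 <-]].
  by exists (complex.Re `|A 0|); exists 0; rewrite //= normr0.
by apply: AC; rewrite -lecR -norm_ReE.
Qed.

(** The uniform bound [C] is needed because [sup] of an unbounded set is 0 by default. *)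
Lemma opnorm_ge A C (x : X) :
  (forall x : X, complex.Re `|x| <= 1 -> complex.Re `|A x| <= C) ->
  complex.Re `|x| <= 1 -> complex.Re `|A x| <= opnorm A.
Proof.
move=> AC x1; apply: ub_le_sup; last first.
  by exists x => //=; rewrite norm_ReE lecR.
by exists C => _ [y /= y1 <-]; apply: AC; rewrite -lecR -norm_ReE.
Qed.

Lemma lipschitz_complex_continuous A (C : R) :
  (forall x y, complex.Re `|A x - A y| <= C * complex.Re `|x - y|) -> continuous A.
Proof.
move=> AC x; apply/cvgrPdist_lt => e /gt0_complexE[e0 ->].
have C0 : 0 < `|C| + 1 by rewrite ltr_wpDl.
have d0 : 0 < complex.Re e / (`|C| + 1) by rewrite divr_gt0.
near=> y; rewrite norm_ReE ltcR; apply: le_lt_trans (AC _ _) _.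
have : `|x - y| < (complex.Re e / (`|C| + 1))%:C%C.
  by near: y; apply: cvgr_dist_lt => //; rewrite ltcR.
rewrite norm_ReE ltcR ltr_pdivlMr //.
have := ler_norm C; have := Re_norm_ge0 (x - y); nra.
Unshelve. all: by end_near. Qed.

(** Surjectivity gives a right inverse by choice; the lower bound makes it Lipschitz, and makes
    [z - T] injective, so that it is also a left inverse. *)
Lemma resolvent_exists (T : {linear X -> X}) (z : R[i]) (C : R) :
  (forall x, complex.Re `|x| <= C * complex.Re `|z *: x - T x|) ->
  (forall x, exists y, z *: y - T y = x) ->
  exists S, resolvent_inverse T z S.
Proof.
move=> lb /choice[S SE]; exists S.
have diffE x y : z *: (x - y) - T (x - y) = (z *: x - T x) - (z *: y - T y).
  by rewrite (linearB T) scalerBr !opprD addrACA.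
split; [|split=> // x].
  apply: (lipschitz_complex_continuous _ C) => x y.
  by apply: le_trans (lb _) _; rewrite diffE !SE.
apply/eqP; rewrite -subr_eq0 -normr_eq0 norm_ReE.
have := lb (S (z *: x - T x) - x); rewrite diffE SE subrr normr0 mulr0 => h.
rewrite (_ : complex.Re _ = 0) //.
by apply/eqP; rewrite eq_le h Re_norm_ge0.
Qed.

Lemma resolvent_opnorm_le (T : {linear X -> X}) (z : R[i]) (C : R) S : 0 <= C ->
  (forall x, complex.Re `|x| <= C * complex.Re `|z *: x - T x|) ->
  resolvent_inverse T z S -> opnorm S <= C.
Proof.
move=> C0 lb [_ [_ SE]]; apply: opnorm_le => x x1.
by rewrite (le_trans (lb _)) // SE ler_piMr.
Qed.

End OperatorNorm.

(** * Distances from points of the unit circle *)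

Section UnitCircle.
Context {R : realType}.
Implicit Types u v z : R[i].

Lemma cabs_sqr z : cabs z ^+ 2 = complex.Re z ^+ 2 + complex.Im z ^+ 2.
Proof. by rewrite cabsE sqr_sqrtr // addr_ge0 ?sqr_ge0. Qed.

(** With [q = cabs (v - 1)], the square of the right side is [eta^2 + (1 - eta) q^2]. As [eta <= q]
    and [1 - eta >= 1/2], the constant 1/5 works because [2/5 + 1/25 <= 1/2]. *)
Lemma cabs_far v (eta : R) : cabs v = 1 -> 0 <= eta <= 1/2 ->
  eta <= cabs (v - 1) -> eta + cabs (v - 1) / 5 <= cabs (v - 1 + eta%:C%C).
Proof.
move=> v1 /andP[eta0 eta1] etav.
have q0 := cabs_ge0 (v - 1).
rewrite -(@ler_pXn2r _ 2) ?nnegrE ?cabs_ge0 //; last by nra.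
rewrite (cabs_sqr (v - 1 + _)).
have := cabs_sqr v; have := cabs_sqr (v - 1).
rewrite v1; move: q0 etav; set q := cabs (v - 1).
case: (v) => a b /=; rewrite oppr0 !addr0 expr1n => q0 etav hq hv.
have -> : (a - 1 + eta) ^+ 2 + b ^+ 2 = eta ^+ 2 + (1 - eta) * q ^+ 2.
  rewrite hq (_ : b ^+ 2 = 1 - a ^+ 2); first by ring.
  by rewrite hv addrC addKr.
have : 0 <= q * (q - eta) by rewrite mulr_ge0 // subr_ge0.
have : 0 <= q ^+ 2 * (1/2 - eta) by rewrite mulr_ge0 ?sqr_ge0 // subr_ge0.
have := sqr_ge0 q; lra.
Qed.

(** The real point [1 - eta] lies in the disc at distance [eta] from the circle. *)
Lemma cabs_near v (eta : R) : cabs v = 1 -> 0 <= eta <= 1 ->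
  eta <= cabs (v - 1 + eta%:C%C).
Proof.
move=> v1 /andP[eta0 eta1].
have -> : v - 1 + eta%:C%C = v - (1 - eta)%:C%C.
  by rewrite rmorphB opprB addrA addrAC.
have := cabs_dist v (1 - eta)%:C%C.
by rewrite cabs_real v1 ger0_norm ?subr_ge0 // subKr.
Qed.

End UnitCircle.

(** * Back substitution in a bidiagonal system *)

Section BackSubstitution.
Context {F : fieldType}.

(** The recursion runs on the distance [j] from the end: the value at [j] is the entry [n - j] of
    the solution of [a y_m - e y_(m+1) = x_m] with [y_n = 0]. *)
Fixpoint back_solve (a e : F) (x : nat -> F) (n j : nat) : F :=
  if j is i.+1 then (x (n - i.+1)%N + e * back_solve a e x n i) / a else 0.

Lemma back_solveP (a e : F) x n m : a != 0 -> (m < n)%N ->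
  a * back_solve a e x n (n - m) - e * back_solve a e x n (n - m.+1) = x m.
Proof.
move=> a0 mn; rewrite -(subnSK mn) /=.
rewrite (_ : n - (n - m.+1).+1 = m)%N; last by lia.
by rewrite mulrC mulfVK // addrK.
Qed.

End BackSubstitution.

(** * The rotated average of identity and shift, and its resolvent *)

Section AveragedShift.
Context (R : realType) (del : nat -> {nonneg R}) (len : nat -> nat).
Context (u : nat -> R[i]) (eta : nat -> R).
Context (u1 : forall k, cabs (u k) = 1) (eta01 : forall k, 0 <= eta k <= 1/2).
Local Notation X := (blockseq R del len).
Local Notation d k := ((del k)%:num).

Let u_neq0 k : u k != 0.
Proof.
by apply/eqP => uk; have := u1 k; rewrite uk cabs0 => /eqP; rewrite eq_sym oner_eq0.
Qed.

(** Defined on raw arrays, so that it applies to candidate solutions not yet known to be bounded. *)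
Definition rot_avg (x : nat -> nat -> R[i]) (k m : nat) : R[i] :=
  u k * ((1 - eta k)%:C%C * x k m + (eta k)%:C%C * x k m.+1).

Lemma blockn_rot_avg x k M B : (forall m, blockn (d k) (x k) m <= B) ->
  blockn (d k) (rot_avg x k) M <= B.
Proof.
move=> xB; have /andP[e0 e1] := eta01 k.
rewrite blocknZ u1 mul1r; apply: le_trans (blocknD _ _ _ _ _) _ => //.
rewrite !blocknZ !cabs_real.
rewrite !ger0_norm //; last by lra.
rewrite [leRHS](_ : B = (1 - eta k) * B + eta k * B); last by ring.
rewrite lerD // ler_wpM2l //; first by lra.
exact: le_trans (blockn_shift _ (x k) M _) (xB _).
Qed.

Lemma rot_avg_mem (x : X) : rot_avg x \in block_mem R del len.
Proof.
apply/block_memP; split.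
  exists (block_norm _ _ _ x) => k M; apply: blockn_rot_avg => m.
  exact: blockn_le_norm.
move=> k m km; rewrite /rot_avg !entry_ge_len ?(leq_trans km) //.
by rewrite !mulr0 addr0 mulr0.
Qed.

Lemma avg_shift_linear :
  exists T : {linear X -> X}, forall x k m, T x k m = rot_avg x k m.
Proof.
pose T (x : X) : X := BlockSeq _ _ _ _ (rot_avg_mem x).
have T_lin : linear T.
  have T_lin c (x y : X) : T (c *: x + y) = c *: T x + T y.
    apply: blockseq_ext => k m.
    change (rot_avg (c *: x + y) k m = c * rot_avg x k m + rot_avg y k m).
    by rewrite /rot_avg !entryD !entryZ; ring.
  exact: T_lin.
pose TM := GRing.isLinear.Build _ _ _ _ T T_lin.
pose TL : {linear X -> X} := HB.pack T TM.
by exists TL.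
Qed.

Context (T : {linear X -> X}).
Context (TE : forall x k m, T x k m = rot_avg x k m).

Lemma avg_shift_norm_le x : block_norm _ _ _ (T x) <= block_norm _ _ _ x.
Proof.
apply: block_norm_le => k M; rewrite (_ : T x k = rot_avg x k); last first.
  by apply/funext => m; rewrite TE.
by apply: blockn_rot_avg => m; exact: blockn_le_norm.
Qed.

Lemma iter_avg_shift_norm_le n x :
  block_norm _ _ _ (iter n T x) <= block_norm _ _ _ x.
Proof. by elim: n => //= n IH; exact: le_trans (avg_shift_norm_le _) IH. Qed.

(** The rotation factors out of the powers, leaving a real averaging process that can be bounded
    below by comparison. *)
Lemma iter_avg_shift_real n (x : X) k (f : nat -> R) :
  (forall m, x k m = (f m)%:C%C) -> forall m,
  iter n T x k m = u k ^+ n *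
    (iter n (fun g i => (1 - eta k) * g i + eta k * g i.+1) f m)%:C%C.
Proof.
move=> xf; elim: n => [m|n IH m]; first by rewrite expr0 mul1r xf.
by rewrite iterS TE /rot_avg !IH /= exprS !rmorphD !rmorphM /=; ring.
Qed.

Context (u_dist : forall k, cabs (u k - 1) = eta k).

(** Dividing by [u k] brings the resolvent equation to the form of [blockn_far] and
    [blockn_near]. *)
Let rotE (x : nat -> nat -> R[i]) z k m :
  (u k)^-1 * (z * x k m - rot_avg x k m) =
  (z / u k - 1 + (eta k)%:C%C) * x k m - (eta k)%:C%C * x k m.+1.
Proof.
have u0 := u_neq0 k.
by rewrite /rot_avg rmorphB /=; field.
Qed.

Let cabsV k : cabs (u k)^-1 = 1.
Proof.
have u0 := u_neq0 k.
by have := cabsM (u k) (u k)^-1; rewrite divff // cabs1 u1 mul1r.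
Qed.

Let cabs_z_u z k : cabs (z / u k - 1) = cabs (z - u k).
Proof.
have u0 := u_neq0 k.
rewrite (_ : z / u k - 1 = (z - u k) * (u k)^-1); last by field.
by rewrite cabsM cabsV mulr1.
Qed.

(** Away from [u k], a zero would force [eta k = 0], hence [u k = 1] and then [z = 1]; close to
    [u k], [eta k] is positive and bounds the modulus below. *)
Let symbol_neq0 z k : cabs z = 1 -> z != 1 -> z / u k - 1 + (eta k)%:C%C != 0.
Proof.
move=> z1 zn1; have /andP[e0 e1] := eta01 k.
have w1 : cabs (z / u k) = 1 by rewrite cabsM z1 cabsV mulr1.
apply/eqP => a0; have [far|near] := leP (eta k) (cabs (z / u k - 1)).
  have := cabs_far (z / u k) (eta k) w1 (eta01 k) far; rewrite a0 cabs0 => phi0.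
  have eta0 : eta k = 0 by have := cabs_ge0 (z / u k - 1); lra.
  have uk : u k = 1.
    by apply/eqP; rewrite -subr_eq0; apply/eqP/cabs_eq0; rewrite u_dist.
  move: phi0; rewrite eta0 uk divr1 add0r => phi0.
  have : cabs (z - 1) = 0 by have := cabs_ge0 (z - 1); lra.
  by move=> /cabs_eq0/eqP; rewrite subr_eq0 (negbTE zn1).
have : eta k <= cabs (z / u k - 1 + (eta k)%:C%C).
  by apply: cabs_near => //; rewrite e0; lra.
by rewrite a0 cabs0; have := cabs_ge0 (z / u k - 1); lra.
Qed.

(** Each block is a finite bidiagonal system with nonzero diagonal. Boundedness across blocks is
    left to [rot_avg_lower_bound]. *)
Lemma rot_avg_solve (x : nat -> nat -> R[i]) z : cabs z = 1 -> z != 1 ->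
  (forall k m, (len k <= m)%N -> x k m = 0) ->
  exists2 y : nat -> nat -> R[i], (forall k m, (len k <= m)%N -> y k m = 0) &
    forall k m, z * y k m - rot_avg y k m = x k m.
Proof.
move=> z1 zn1 x0.
pose y k m := back_solve (z / u k - 1 + (eta k)%:C%C) (eta k)%:C%C
  (fun m => (u k)^-1 * x k m) (len k) (len k - m).
have y0 k m : (len k <= m)%N -> y k m = 0.
  by rewrite /y -subn_eq0 => /eqP ->.
exists y => // k m; apply: (mulfI (invr_neq0 (u_neq0 k))); rewrite rotE.
have [km|mk] := leqP (len k) m.
  by rewrite !y0 ?(leq_trans km) // x0 // !mulr0 subr0.
by rewrite /y back_solveP // symbol_neq0.
Qed.

(** On each block the comparison of [cabs (z - u k)] with [eta k] decides between [blockn_far] and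
    [blockn_near]. *)
Lemma rot_avg_lower_bound (alpha C : R) (z : R[i]) :
  1 <= alpha -> 0 <= C ->
  (forall k, 0 < eta k -> 0 < d k <= 1 /\ eta k `^ alpha <= C * (eta k * d k)) ->
  cabs z = 1 -> z != 1 -> forall (x : nat -> nat -> R[i]) (B : R),
  (forall k m, (len k <= m)%N -> x k m = 0) ->
  (forall k M, blockn (d k) (fun m => z * x k m - rot_avg x k m) M <= B) ->
  forall k M, blockn (d k) (x k) M <= (5 + 3 * C) * (cabs (z - 1) / 2) `^ (- alpha) * B.
Proof.
move=> alpha1 C0 etad z1 zn1 x B x_len xB k M.
have q0 : 0 < cabs (z - 1).
  rewrite lt_neqAle cabs_ge0 andbT eq_sym; apply: contra zn1 => /eqP/cabs_eq0.
  by move=> /eqP; rewrite subr_eq0.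
have q2 : cabs (z - 1) <= 2 by rewrite (le_trans (cabsB _ _)) // z1 cabs1; lra.
have /andP[e0 e1] := eta01 k.
set q := cabs (z - 1) in q0 q2 *.
have qphi : q <= cabs (z - u k) + eta k.
  by rewrite -u_dist (le_trans _ (cabsD _ _)) // addrA subrK.
pose w := z / u k; have w1 : cabs w = 1 by rewrite cabsM z1 cabsV mulr1.
have B0 : 0 <= B by apply: le_trans (xB k 0%N); exact: blockn_ge0.
pose y m := (u k)^-1 * (z * x k m - rot_avg x k m).
have yB m : blockn (d k) y m <= B by rewrite blocknZ cabsV mul1r.
have x0 m : (len k <= m)%N -> x k m = 0 by exact: x_len.
have yE m : y m = (w - 1 + (eta k)%:C%C) * x k m - (eta k)%:C%C * x k m.+1.
  by rewrite /y rotE.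
have pw : 0 < (q / 2) `^ alpha by rewrite powR_gt0 // divr_gt0.
rewrite powRN; have [far|near] := leP (eta k) (cabs (z - u k)).
  (* The gap [cabs (z - u k) / 5] gives the constant 5, and [q / 2 <= cabs (z - u k)]. As
     [q / 2 <= 1 <= alpha], the power [alpha] only weakens the bound. *)
  have phi0 : 0 < cabs (z - u k) by lra.
  have far_w : eta k + cabs (z - u k) / 5 <= cabs (w - 1 + (eta k)%:C%C).
    by rewrite -cabs_z_u; apply: cabs_far; rewrite ?cabs_z_u ?e0.
  have eta_w : eta k < cabs (w - 1 + (eta k)%:C%C) by lra.
  apply: le_trans (blockn_far _ _ _ _ _ _ _ _ _ e0 eta_w yE x0 yB) _ => //.
  rewrite mulrC ler_wpM2r //.
  have qa : (q / 2) `^ alpha <= q / 2 by rewrite ge1r_powR //; lra.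
  have le5 : 5 * ((q / 2) `^ alpha)^-1 <= (5 + 3 * C) * ((q / 2) `^ alpha)^-1.
    by rewrite ler_wpM2r ?invr_ge0 ?(ltW pw) //; lra.
  apply: le_trans le5; rewrite -[5]invrK -invfM lef_pV2 ?posrE; lra.
(* Now [q / 2 <= eta k], so [(q / 2) ^ alpha <= C * (eta k * d k)]; the factor [2 + d k <= 3] gives
   [3 * C]. *)
have eta0 : 0 < eta k by exact: le_lt_trans (cabs_ge0 _) near.
have [/andP[d0 d1] eta_alpha] := etad k eta0.
have near_w : eta k <= cabs (w - 1 + (eta k)%:C%C).
  by apply: cabs_near => //; rewrite e0; lra.
apply: le_trans (blockn_near _ _ _ _ _ _ _ _ d0 eta0 near_w yE x0 yB) _.
rewrite ler_wpM2r // ler_pdivrMr ?mulr_gt0 //.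
have qa : (q / 2) `^ alpha <= eta k `^ alpha.
  by apply: ge0_ler_powR; rewrite ?nnegrE; lra.
rewrite mulrAC ler_pdivlMr //.
have : (2 + d k) * (q / 2) `^ alpha <= 3 * (C * (eta k * d k)).
  by rewrite ler_pM ?addr_ge0 ?(ltW pw) ?(le_trans qa) //; lra.
have : 0 <= eta k * d k by rewrite mulr_ge0 // ltW.
by lra.
Qed.


Lemma avg_shift_lower_bound (alpha C : R) (z : R[i]) :
  1 <= alpha -> 0 <= C ->
  (forall k, 0 < eta k -> 0 < d k <= 1 /\ eta k `^ alpha <= C * (eta k * d k)) ->
  cabs z = 1 -> z != 1 -> forall x,
  block_norm _ _ _ x <=
    (5 + 3 * C) * (cabs (z - 1) / 2) `^ (- alpha) * block_norm _ _ _ (z *: x - T x).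
Proof.
move=> alpha1 C0 etad z1 zn1 x; apply: block_norm_le.
apply: (rot_avg_lower_bound _ _ _ alpha1 C0 etad z1 zn1) => [|k M]; first exact: entry_ge_len.
have -> : (fun m => z * x k m - rot_avg x k m) = (z *: x - T x) k.
  by apply/funext => m; rewrite entryB entryZ TE.
exact: blockn_le_norm.
Qed.

(** The a priori estimate, applied to the raw solution, shows that it is bounded and so belongs to
    the space. *)
Lemma avg_shift_surjective (alpha C : R) (z : R[i]) :
  1 <= alpha -> 0 <= C ->
  (forall k, 0 < eta k -> 0 < d k <= 1 /\ eta k `^ alpha <= C * (eta k * d k)) ->
  cabs z = 1 -> z != 1 -> forall x, exists y, z *: y - T y = x.
Proof.
move=> alpha1 C0 etad z1 zn1 x.
have [y y0 yE] := rot_avg_solve x z z1 zn1 (entry_ge_len _ _ _ x).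
have y_mem : y \in block_mem R del len.
  apply/block_memP; split=> //.
  exists ((5 + 3 * C) * (cabs (z - 1) / 2) `^ (- alpha) * block_norm _ _ _ x).
  apply: (rot_avg_lower_bound _ _ _ alpha1 C0 etad z1 zn1) => // k M.
  by rewrite (_ : (fun m => _) = x k) ?blockn_le_norm //; apply/funext => m.
exists (BlockSeq _ _ _ y y_mem); apply: blockseq_ext => k m.
by rewrite entryB entryZ TE.
Qed.

End AveragedShift.

(** * Binomial concentration, window vectors and elementary limits *)

Section Window.
Context {R : realType}.
Implicit Types (a c h Lsq : R) (f : nat -> R).

(* Chebyshev's inequality for the binomial distribution of parameters [n], [h]:
   averaging maps quadratic minorants to quadratic minorants. *)
Lemma iter_avg_quadratic a c h Lsq f n : 0 <= h <= 1 ->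
  (forall m, a * (1 - (m%:R - c) ^+ 2 / Lsq) <= f m) -> forall m,
  a * (1 - ((m%:R - c + n%:R * h) ^+ 2 + n%:R * h * (1 - h)) / Lsq) <=
  iter n (fun g i => (1 - h) * g i + h * g i.+1) f m.
Proof.
move=> /andP[h0 h1] fge; elim: n => [|n IH] m; first by rewrite !mul0r !addr0 fge.
rewrite iterS.
have := lerD (ler_wpM2l (_ : 0 <= 1 - h) (IH m)) (ler_wpM2l h0 (IH m.+1)).
rewrite subr_ge0 => /(_ h1); apply: le_trans; rewrite le_eqVlt; apply/orP; left; apply/eqP.
by rewrite -!natr1; ring.
Qed.

Lemma sum_window_le (p q M : nat) :
  \sum_(m < M) ((p <= m <= q)%N)%:R <= (q.+1 - p)%:R :> R.
Proof.
rewrite -natr_sum ler_nat.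
suff -> : (\sum_(m < M) (p <= m <= q) = minn M q.+1 - p)%N by lia.
by elim: M => [|M IH]; [rewrite big_ord0 | rewrite big_ord_recr /= IH]; lia.
Qed.

(** Outside the window [m] is at distance at least [L] from [c], so the parabola is nonpositive.
    This supplies the minorant for [iter_avg_quadratic]. *)
Lemma window_ge_quadratic c (L m : nat) : (0 < L)%N -> 0 <= c ->
  1 - (m%:R - c) ^+ 2 / L%:R ^+ 2 <=
  ((Num.truncn c - L <= m <= Num.truncn c + L)%N)%:R :> R.
Proof.
move=> L0 c0; have /andP[t1 t2] := truncn_itv c0.
have L0' : 0 < (L%:R : R) by rewrite ltr0n.
have [_|out] := boolP (_ <= m <= _)%N; first by rewrite gerBl divr_ge0 ?sqr_ge0.
rewrite subr_le0 ler_pdivlMr ?exprn_gt0 // mul1r.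
have [out1|out1] : (m + L < Num.truncn c)%N \/ (Num.truncn c + L + 1 <= m)%N by lia.
  have : (m + L)%:R <= (Num.truncn c)%:R :> R by rewrite ler_nat ltnW.
  by rewrite natrD => h; nra.
have : (Num.truncn c + L + 1)%:R <= m%:R :> R by rewrite ler_nat.
by move: t2; rewrite -natr1 !natrD => h t2; nra.
Qed.

Lemma exprD1_le_expR (x : R) n : 0 <= x -> (1 + x) ^+ n <= expR (n%:R * x).
Proof.
by move=> x0; rewrite expRM_natl lerXn2r ?nnegrE ?expR_ge0 ?addr_ge0 // expR_ge1Dx.
Qed.

(** At most [q.+1 - p] terms contribute, each with weight at most [(1 + d)^q <= exp (q d)]. *)
Lemma blockn_window_le (d : R) (x : nat -> R[i]) (p q M : nat) : 0 <= d ->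
  (forall m, cabs (x m) = ((p <= m <= q)%N)%:R) ->
  blockn d x M <= 1 + d * (q.+1 - p)%:R * expR (q%:R * d).
Proof.
move=> d0 xE; rewrite /blockn xE lerD ?lern1 ?leq_b1 // -mulrA ler_wpM2l //.
have le_term (m : 'I_M) : true ->
    cabs (x m) * (1 + d) ^+ m <= ((p <= m <= q)%N)%:R * expR (q%:R * d).
  move=> _; rewrite xE; case: andP => [[_ mq]|_]; rewrite ?mul0r // !mul1r.
  apply: le_trans (exprD1_le_expR d m d0) _.
  by rewrite ler_expR ler_wpM2r // ler_nat.
apply: le_trans (ler_sum _ le_term) _.
by rewrite -mulr_suml ler_wpM2r ?expR_ge0 // sum_window_le.
Qed.

Lemma limn_esup_gt0 (v : nat -> R) (c : R) : 0 < c ->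
  (forall m, exists2 n, (m <= n)%N & c <= v n) ->
  (0 < limn_esup (fun n => (v n)%:E))%E.
Proof.
move=> c0 vc; apply: (@lt_le_trans _ _ c%:E); first by rewrite lte_fin.
apply: le_ereal_inf_tmp => _ [V [N _ NV] <-].
have [n Nn cn] := vc N; apply: (@le_trans _ _ (v n)%:E); first by rewrite lee_fin.
by apply: ereal_sup_ubound; exists n => //; exact: NV.
Qed.

(** Mean value theorem on an interval around 0 where the cosine exceeds 1/2. *)
Lemma sin_ge_half : exists2 t0 : R, 0 < t0 &
  forall t, 0 < `|t| < t0 -> `|t| / 2 <= `|sin t|.
Proof.
have : \forall t \near (0 : R), 1 / 2 < cos t.
  have cos_cvg : cos t @[t --> (0 : R)] --> cos 0 by exact: continuous_cos.
  by apply: (cvgr_gt _ cos_cvg); rewrite cos0; lra.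
move=> /nbhs_ballP[t0 /= t00 cosP]; exists t0 => //.
have pos t : 0 < t < t0 -> t / 2 <= sin t.
  move=> /andP[t1 t2].
  have sin_cont : {within `[0, t], continuous (@sin R)}.
    by apply: continuous_subspaceT => x; exact: continuous_sin.
  have [x /itvP xt xE] := MVT t1 (fun x _ => is_derive_sin x) sin_cont.
  have : 1 / 2 < cos x.
    by apply: cosP; rewrite /= /ball /= sub0r normrN gtr0_norm ?(lt_trans _ t2) ?xt.
  by move: xE; rewrite sin0 !subr0 => ->; nra.
move=> t; have [t1|t1] := leP 0 t.
  rewrite ger0_norm // => /pos h; rewrite (le_trans h) ?ler_norm //.
rewrite ltr0_norm // => /pos; rewrite sinN => h.
by rewrite (le_trans h) // -normrN ler_norm.
Qed.

End Window.

(** * Lower bound for the powers applied to the defect *)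

Section DecayLowerBound.
Context (R : realType) (del : nat -> {nonneg R}) (len : nat -> nat).
Context (u : nat -> R[i]) (eta : nat -> R).
Context (u1 : forall k, cabs (u k) = 1) (eta01 : forall k, 0 <= eta k <= 1/2).
Local Notation X := (blockseq R del len).
Local Notation d k := ((del k)%:num).
Context (T : {linear X -> X}).
Context (TE : forall x k m, T x k m = rot_avg R u eta x k m).

Lemma iter_linearB n (x y : X) : iter n T (x - y) = iter n T x - iter n T y.
Proof. by elim: n => //= n ->; rewrite linearB. Qed.

Lemma iter_defect_norm_le n (x : X) :
  complex.Re `|iter n T (x - T x)| <= 2 * complex.Re `|x|.
Proof.
apply: le_trans (iter_avg_shift_norm_le _ _ _ _ _ u1 eta01 _ TE _ _) _.
have := ler_normB x (T x); rewrite !block_normE -rmorphD lecR => h.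
apply: le_trans h _; rewrite mulr2n mulrDl mul1r lerD2l.
exact: avg_shift_norm_le u1 eta01 _ TE _.
Qed.

(** The test vector is a normalised window around the mean [c] of the binomial law with parameters
    [n.+1] and [eta k]. Most of this law falls in the window, so the average seen at position 0 is
    still at least [1 / (2 C)]. *)
Lemma opnorm_defect_ge k n (L : nat) (C : R) : (0 < L)%N -> 0 < C ->
  let c := n.+1%:R * eta k in
  2 * c <= L%:R ^+ 2 -> (Num.truncn c + L < len k)%N ->
  1 + d k * (2 * L + 1)%:R * expR ((c + L%:R) * d k) <= C ->
  `|complex.Im (u k)| / (2 * C) <= opnorm (fun x : X => iter n T (x - T x)).
Proof.
move=> L0 C0 c cL lenk CE.
have /andP[e0 e1] := eta01 k.
have c0 : 0 <= c by rewrite mulr_ge0.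
pose p := (Num.truncn c - L)%N; pose q := (Num.truncn c + L)%N.
pose f m := C^-1 * ((p <= m <= q)%N)%:R.
pose w i m : R[i] := if i == k then (f m)%:C%C else 0.
have w_le i M : blockn (d i) (w i) M <= 1.
  rewrite /w; case: eqP => [->|_]; last first.
    by rewrite /blockn cabs0 big1 => [|m _]; rewrite ?mul0r // mulr0 addr0.
  rewrite (_ : (fun m => _) =
      fun m => C^-1%:C%C * (((p <= m <= q)%N)%:R : R)%:C%C); last first.
    by apply/funext => m; rewrite /f rmorphM.
  rewrite blocknZ cabs_real gtr0_norm ?invr_gt0 // mulrC ler_pdivrMr // mul1r.
  apply: le_trans (blockn_window_le (d k) _ p q M (ge0 (del k)) _) _.
    by move=> m; rewrite cabs_real ger0_norm.
  apply: le_trans CE; rewrite lerD2l ler_pM ?mulr_ge0 ?expR_ge0 //.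
    by rewrite ler_wpM2l // ler_nat /p /q; lia.
  rewrite ler_expR ler_wpM2r // natrD lerD2r.
  by have /andP[] := truncn_itv c0.
have w_mem : w \in block_mem R del len.
  apply/block_memP; split; first by exists 1.
  move=> i m; rewrite /w /f; case: eqP => // -> km.
  by rewrite (_ : (_ <= m <= _)%N = false) ?mulr0 // /q; lia.
pose x : X := BlockSeq _ _ _ w w_mem.
have x1 : complex.Re `|x| <= 1 by apply: block_norm_le => i M; exact: w_le.
have A_le (y : X) : complex.Re `|y| <= 1 -> complex.Re `|iter n T (y - T y)| <= 2.
  by have := iter_defect_norm_le n y; lra.
apply: le_trans (opnorm_ge (fun x : X => iter n T (x - T x)) 2 x A_le x1).
apply: le_trans (cabs_le_norm R del len (iter n T (x - T x)) k 0).
have xk m : x k m = (f m)%:C%C by rewrite /= /w eqxx.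
rewrite iter_linearB -iterSr entryB !(iter_avg_shift_real _ _ _ _ _ _ TE _ x k f xk).
pose F i := iter i (fun g j => (1 - eta k) * g j + eta k * g j.+1) f 0%N.
rewrite -/(F n) -/(F n.+1).
have -> : u k ^+ n * (F n)%:C%C - u k ^+ n.+1 * (F n.+1)%:C%C =
    u k ^+ n * ((F n)%:C%C - u k * (F n.+1)%:C%C) by rewrite exprS; ring.
have cabsX m : cabs (u k ^+ m) = 1.
  by elim: m => [|m IH]; rewrite ?cabs1 // exprS cabsM u1 IH mulr1.
rewrite cabsM cabsX mul1r; apply: le_trans (cabs_ge_Im _).
(* Since [F n] is real, the imaginary part discards it and keeps only [F n.+1], so the two terms
   cannot cancel. *)
rewrite (_ : complex.Im ((F n)%:C%C - _) = - (complex.Im (u k) * F n.+1)); last first.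
  by move: (F n) (F n.+1) => r s; case: (u k) => a b; simpc.
rewrite normrN normrM ler_wpM2l ?normr_ge0 //.
apply: le_trans (ler_norm _).
have f_ge m : C^-1 * (1 - (m%:R - c) ^+ 2 / L%:R ^+ 2) <= f m.
  by apply: ler_wpM2l; [rewrite invr_ge0 ltW | exact: window_ge_quadratic].
have eta1 : 0 <= eta k <= 1 by lra.
have := iter_avg_quadratic _ _ _ _ _ n.+1 eta1 f_ge 0.
rewrite -/(F n.+1) -/c; apply: le_trans.
rewrite invfM mulrC ler_pM2l ?invr_gt0 // sub0r addNr expr0n add0r.
(* The variance [c (1 - eta k)] is at most half of [L^2], so the quadratic minorant keeps at least
   half of the mass. *)
have : c * (1 - eta k) / L%:R ^+ 2 <= 1 / 2.
  rewrite ler_pdivrMr ?exprn_gt0 ?ltr0n //.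
  by have := mulr_ge0 c0 e0; lra.
by rewrite (_ : 2^-1 = 1 / 2 :> R); lra.
Qed.

End DecayLowerBound.

(** * Parameters of the blocks and growth rates *)

Section Rates.
Context {R : realType} (alpha : R) (halpha : 2 < alpha).

(** The coordinates solve [|z| = 1] and [|z - 1| = e]; the square root is at least 1/2 for such
    [e]. *)
Lemma circle_point (e : R) : 0 <= e <= 1/2 ->
  let z := ((1 - e ^+ 2 / 2) +i* (e * Num.sqrt (1 - e ^+ 2 / 4)))%C in
  [/\ cabs z = 1, cabs (z - 1) = e & e / 2 <= complex.Im z].
Proof.
move=> /andP[e0 e1] z.
have s0 : 0 <= 1 - e ^+ 2 / 4 by nra.
have sq : (e * Num.sqrt (1 - e ^+ 2 / 4)) ^+ 2 = e ^+ 2 * (1 - e ^+ 2 / 4).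
  by rewrite exprMn sqr_sqrtr.
split.
- rewrite cabsE /= sq [X in Num.sqrt X](_ : _ = 1) ?sqrtr1 //; by field.
- rewrite cabsE /= oppr0 addr0 sq [X in Num.sqrt X](_ : _ = e ^+ 2); last by field.
  by rewrite sqrtr_sqr ger0_norm.
- rewrite /= ler_wpM2l // -(@ler_pXn2r _ 2) ?nnegrE ?sqrtr_ge0 //.
  by rewrite sqr_sqrtr //; nra.
Qed.

Definition par_del (k : nat) : {nonneg R} := ((k%:R^-1 : R) ^+ 4)%:nng.

(** Room for a window centred below [k^5] with half-width [k^3]; the added 1 also leaves one entry
    in block 0. *)
Definition par_len (k : nat) : nat := (k ^ 5 + k ^ 3 + 1)%N.

(** With this exponent, [par_eta] to the power [alpha - 1] is comparable to [k^-4], that is, to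
    [par_del]. *)
Let beta : R := 4 / (alpha - 1).

(* At [k = 0] both [par_del] and [par_eta] vanish, since [0^-1 = 0] and
   [0 `^ (- beta) = 0]; the operator is the identity on that block. *)
Definition par_eta (k : nat) : R := 2^-1 * k%:R `^ (- beta).

Definition par_rot (k : nat) : R[i] :=
  let e := par_eta k in
  ((1 - e ^+ 2 / 2) +i* (e * Num.sqrt (1 - e ^+ 2 / 4)))%C.

Let beta_gt0 : 0 < beta.
Proof. by rewrite divr_gt0 //; move: halpha; lra. Qed.

Lemma par_eta0 : par_eta 0 = 0.
Proof. by rewrite /par_eta powR0 ?mulr0 // oppr_eq0 gt_eqF. Qed.

Lemma par_eta_gt0 k : (0 < k)%N -> 0 < par_eta k.
Proof. by move=> k0; rewrite mulr_gt0 ?invr_gt0 // powR_gt0 // ltr0n. Qed.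

Lemma par_eta_bound k : 0 <= par_eta k <= 1/2.
Proof.
case: k => [|k]; first by rewrite par_eta0; lra.
rewrite ltW ?par_eta_gt0 //=.
have : k.+1%:R `^ (- beta) <= k.+1%:R `^ 0 :> R.
  by rewrite ler_powR ?ler1n // oppr_le0 ltW.
by rewrite powRr0 /par_eta; lra.
Qed.

(** The exponents agree because [beta * alpha = beta + 4]. *)
Lemma par_eta_powR k : (0 < k)%N ->
  par_eta k `^ alpha = (2^-1) `^ alpha * (2 * par_eta k * (k%:R^-1) ^+ 4).
Proof.
move=> k0; have k0' : (k%:R : R) != 0 by rewrite pnatr_eq0 -lt0n.
rewrite /par_eta powRM ?powR_ge0 // -powRrM; congr (_ * _).
have -> : - beta * alpha = - beta + - 4%:R.
  by rewrite /beta; field; apply: lt0r_neq0; move: halpha; lra.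
rewrite powRD ?k0' ?implybT // (powRN _ 4%:R) powR_mulrn // exprVn.
by congr (_ * _); field.
Qed.

Lemma ln_ge_half (r : R) : 2 <= r -> 1 / 2 <= ln r.
Proof.
move=> r2; have r0 : 0 < r by lra.
have : ln (1 + (r^-1 - 1)) <= r^-1 - 1.
  apply: le_ln1Dx; have : 0 < r^-1 by rewrite invr_gt0.
  by lra.
rewrite addrC subrK lnV ?posrE //.
have : r^-1 <= 2^-1 by rewrite lef_pV2 ?posrE //; lra.
by lra.
Qed.

(** Taking [n.+1] as the integer part of [j^4 ln j / par_eta j] keeps the binomial mean below
    [j^4 ln j]. Then [ln n] is at most of order [ln j], and [n / ln n] is at least of order
    [j^4 / par_eta j], which is comparable to [par_eta j ^ (- alpha)]. *)
Lemma growth : exists2 K : R, 0 < K & forall j : nat, (2 <= j)%N ->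
  exists2 n : nat, (j <= n)%N &
    n.+1%:R * par_eta j <= j%:R ^+ 4 * ln (j%:R : R) /\
    K <= par_eta j * (n%:R / ln (n%:R : R)) `^ alpha^-1.
Proof.
have s0 : 0 < (2^-1 : R) `^ alpha by rewrite powR_gt0 // invr_gt0.
have b0 := beta_gt0.
(* The 6 comes from [ln Y]: 4 from [r ^+ 4], and one each from [ln (ln r)] and [ln 2], both at most
   [ln r]. *)
pose K0 : R := (2^-1) `^ alpha / (6 + beta).
have K00 : 0 < K0 by rewrite divr_gt0 //; lra.
exists (K0 `^ alpha^-1); first by rewrite powR_gt0.
move=> j j2; have j0 : (0 < j)%N by apply: ltn_trans j2.
have e0 := par_eta_gt0 j j0; have /andP[_ e1] := par_eta_bound j.
set e := par_eta j in e0 e1 *; set r : R := j%:R.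
have r2 : 2 <= r by rewrite ler_nat.
have r0 : 0 < r by lra.
have lnr := ln_ge_half r r2.
have r4 : r * 8 <= r ^+ 4.
  have : 2 ^+ 3 <= r ^+ 3 by rewrite lerXn2r ?nnegrE //; lra.
  by rewrite (exprS r 3) => h; nra.
pose Y := r ^+ 4 * ln r / e.
have YE : Y * e = r ^+ 4 * ln r by rewrite /Y mulfVK // gt_eqF.
have Yr : r ^+ 4 <= Y by rewrite /Y -mulrA ler_peMr // ?ler_pdivlMr //; lra.
have Y0 : 0 <= Y by lra.
have /andP[tY Yt] := trunc_itv Y0.
have tpos : (0 < Num.trunc Y)%N.
  by rewrite -(ltr_nat R); move: Yt; rewrite -natr1; lra.
exists (Num.trunc Y).-1.
  rewrite -ltnS prednK // -(ltr_nat R).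
  by move: Yt; rewrite -natr1 -/r; lra.
rewrite prednK //; split; first by rewrite -YE ler_wpM2r // ltW.
set n := (Num.trunc Y).-1.
have nE : (n%:R : R) = (Num.trunc Y)%:R - 1 by rewrite -[in RHS](prednK tpos) -natr1 addrK.
(* Truncation and predecessor cost at most 2, which is less than half of [Y] since
   [Y >= r ^+ 4 >= 16]. *)
have nY : Y / 2 <= n%:R by move: Yt; rewrite nE -natr1; lra.
have n1 : 1 < (n%:R : R) by lra.
have lnn0 : 0 < ln (n%:R : R) by rewrite ln_gt0.
have lnn : ln (n%:R : R) <= (6 + beta) * ln r.
  have : ln (n%:R : R) <= ln Y by rewrite ler_ln ?posrE; lra.
  have -> : ln Y = 4 * ln r + ln (ln r) + (ln 2 + beta * ln r).
    rewrite /Y lnM ?posrE ?mulr_gt0 ?invr_gt0 ?exprn_gt0 //; last by lra.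
    rewrite lnM ?posrE ?exprn_gt0 //; last by lra.
    rewrite lnXn // lnV ?posrE // /e /par_eta lnM ?posrE ?invr_gt0 ?powR_gt0 //.
    by rewrite lnV ?posrE // ln_powR -/r mulr_natl; ring.
  have : ln 2 <= ln r by rewrite ler_ln ?posrE.
  have : ln (ln r) < ln r by apply: ln_sublinear; lra.
  by lra.
have nln : K0 * e `^ (- alpha) <= n%:R / ln n%:R.
  rewrite ler_pdivlMr // powRN.
  have ea : e `^ alpha = (2^-1) `^ alpha * (2 * e * (r^-1) ^+ 4).
    exact: par_eta_powR.
  have -> : K0 / e `^ alpha = Y / 2 / ((6 + beta) * ln r).
    rewrite ea /K0 /Y; field.
    by rewrite !gt_eqF //; lra.
  apply: le_trans nY; rewrite mulrAC ler_pdivrMr; last by rewrite mulr_gt0 //; lra.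
  by rewrite ler_wpM2l //; lra.
have a0 : 0 < alpha by move: halpha; lra.
have : (K0 * e `^ (- alpha)) `^ alpha^-1 <= (n%:R / ln n%:R) `^ alpha^-1.
  apply: ge0_ler_powR; rewrite ?nnegrE ?invr_ge0 ?(ltW a0) //.
    by rewrite mulr_ge0 ?powR_ge0 // ltW.
  by rewrite divr_ge0 // ltW.
rewrite powRM ?powR_ge0 ?(ltW K00) // -powRrM mulNr divff ?gt_eqF //.
rewrite powR_inv1 ?(ltW e0) // ler_pdivrMr // => h.
by rewrite mulrC.
Qed.

Lemma chord_ge : exists2 t0 : R, 0 < t0 & forall t, 0 < `|t| < t0 ->
  `|t| / 2 <= cabs (expi t - 1).
Proof.
have [t0 t00 sinP] := @sin_ge_half R; exists t0 => // t /sinP h.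
by apply: le_trans h _; apply: le_trans (cabs_ge_Im _); rewrite /= oppr0 addr0.
Qed.

Lemma cabs_expi (t : R) : cabs (expi t) = 1.
Proof. by rewrite cabsE /= cos2Dsin2 sqrtr1. Qed.

End Rates.

(** The half-width [j^3] lies between the standard deviation, at most about [j^2 sqrt (ln j)], and
    [1 / d = j^4]. The weight [exp (c d) <= j] is compensated by [d (2 j^3 + 1) <= 3 / j]. *)
Lemma block_parameters (R : realType) (j : nat) (c : R) :
  (2 <= j)%N -> 0 <= c -> c <= j%:R ^+ 4 * ln (j%:R : R) ->
  [/\ 2 * c <= (j ^ 3)%:R ^+ 2,
      (Num.truncn c + j ^ 3 < par_len j)%N &
      1 + (@par_del R j)%:num * (2 * j ^ 3 + 1)%:R *
        expR ((c + (j ^ 3)%:R) * (@par_del R j)%:num) <= 1 + 3 * expR 1].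
Proof.
move=> j2 c0 cle; pose r : R := j%:R.
have r2 : 2 <= r by rewrite ler_nat.
have r0 : 0 < r by lra.
have lnr0 := ln_ge_half r r2; have lnr := ln_sublinear r0.
rewrite -/r in cle; have rj : (j ^ 3)%:R = r ^+ 3 by rewrite natrX.
have r40 : 0 < r ^+ 4 by rewrite exprn_gt0.
split.
- rewrite rj -exprM (exprD r 4 2).
  have : r ^+ 4 * (2 * ln r) <= r ^+ 4 * r ^+ 2.
    by rewrite ler_pM2l // expr2; nra.
  by lra.
- have : (Num.truncn c <= j ^ 5)%N; last by rewrite /par_len; lia.
  rewrite -(ler_nat R); have /andP[tc _] := truncn_itv c0.
  apply: (le_trans tc); apply: (le_trans cle).
  by rewrite natrX -/r (exprSr r 4) ler_pM2l // ltW.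
rewrite lerD2l /= -/r.
have d0 : 0 < r^-1 ^+ 4 by rewrite exprn_gt0 ?invr_gt0.
have dlin : r^-1 ^+ 4 * (2 * j ^ 3 + 1)%:R <= 3 / r.
  rewrite natrD natrM rj exprVn ler_pdivlMr // -mulrA ler_pdivrMl //.
  have r31 : 1 <= r ^+ 3 by rewrite exprn_ege1 //; lra.
  by rewrite (exprSr r 3) mulrAC ler_pM2r //; lra.
have dexp : expR ((c + (j ^ 3)%:R) * r^-1 ^+ 4) <= r * expR 1.
  rewrite -{2}(lnK (_ : r \in Num.pos)) ?posrE // -expRD ler_expR.
  rewrite exprVn ler_pdivrMr // rj mulrDl mul1r.
  have : r ^+ 3 <= r ^+ 4 by rewrite (exprSr r 3) ler_peMr ?exprn_ge0 //; lra.
  by lra.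
apply: (@le_trans _ _ (3 / r * (r * expR 1))).
  apply: ler_pM dlin dexp; last exact: expR_ge0.
  by rewrite mulr_ge0 // ltW.
by rewrite mulrA mulfVK // gt_eqF.
Qed.

(** * Verification of the required properties *)

Theorem theorem3p6 (R : realType) (alpha : R) (halpha : 2 < alpha) :
  exists (X : completeNormedModType R[i]) (T : {linear X -> X}),
    (exists x : X, x != 0) /\
    continuous T /\
    (exists M : R, forall n : nat, opnorm (iter n T) <= M) /\
    spectrum T `&` unit_circle = [set 1] /\
    (exists (K : R) (delta : R), 0 < delta /\
       forall theta : R, 0 < `|theta| < delta ->
         forall S : X -> X, resolvent_inverse T (expi theta) S ->
           opnorm S <= K * `|theta| `^ (- alpha)) /\
    (0 < limn_esup (fun n : nat =>
        (opnorm (fun x => iter n T (x - T x)) *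
         (n%:R / ln n%:R) `^ alpha^-1)%:E))%E.
Proof.
have a0 : 0 < alpha by lra.
pose u := par_rot alpha; pose eta := par_eta alpha.
have eta01 k : 0 <= eta k <= 1/2 by exact: par_eta_bound.
have uP k : [/\ cabs (u k) = 1, cabs (u k - 1) = eta k & eta k / 2 <= complex.Im (u k)].
  by exact: circle_point.
have u1 k : cabs (u k) = 1 by case: (uP k).
have u_dist k : cabs (u k - 1) = eta k by case: (uP k).
have [T TE] := avg_shift_linear R par_del par_len u eta u1 eta01.
have etad k : 0 < eta k -> 0 < (@par_del R k)%:num <= 1 /\
    eta k `^ alpha <= 1 * (eta k * (@par_del R k)%:num).
  case: k => [|k]; first by rewrite /eta par_eta0 // ltxx.
  move=> e0; have k0 : 0 < (k.+1%:R : R) by rewrite ltr0n.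
  split.
    rewrite exprn_gt0 ?invr_gt0 //= exprn_ile1 ?invr_ge0 ?(ltW k0) //.
    by rewrite invf_le1 // ler1n.
  rewrite /eta par_eta_powR //= -/(eta k.+1) mul1r.
  (* This cancels the factor 2 in [par_eta_powR], so the constant of the resolvent bound can be
     1. *)
  have half : (2^-1 : R) `^ alpha <= 2^-1 by rewrite ge1r_powR; lra.
  set q := k.+1%:R^-1 ^+ 4.
  have p0 : 0 <= eta k.+1 * q by rewrite mulr_ge0 ?(ltW e0) // exprn_ge0 // invr_ge0 ltW.
  by have := ler_wpM2r p0 half; clear p0; clearbody q; lra.
have alpha1 : 1 <= alpha by lra.
have lb z : cabs z = 1 -> z != 1 -> forall x, complex.Re `|x| <=
    (5 + 3 * 1) * (cabs (z - 1) / 2) `^ (- alpha) * complex.Re `|z *: x - T x|.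
  exact: (avg_shift_lower_bound _ _ _ _ _ u1 eta01 T TE u_dist alpha 1 z alpha1 ler01 etad).
have surj z : cabs z = 1 -> z != 1 -> forall x, exists y, z *: y - T y = x.
  exact: (avg_shift_surjective _ _ _ _ _ u1 eta01 T TE u_dist alpha 1 z alpha1 ler01 etad).
(* The single entry of block 0, where the operator is the identity, gives an eigenvector for the
   eigenvalue 1. *)
have e_mem : (fun k m => ((k == 0%N) && (m == 0%N))%:R : R[i])
    \in block_mem R par_del par_len.
  apply/block_memP; split; last by move=> [|k] [|m].
  exists 1 => -[|k] M; last first.
    by rewrite /blockn cabs0 big1 => [|m _]; rewrite ?cabs0 ?mul0r // mulr0 addr0.
  rewrite /blockn /= invr0 expr0n mul0r addr0.
  by case: M => [|M]; rewrite ?cabs1 ?cabs0.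
pose e0 : blockseq R par_del par_len := BlockSeq _ _ _ _ e_mem.
have e0_neq0 : e0 != 0.
  apply/eqP => /(congr1 (fun x : blockseq R par_del par_len => x 0%N 0%N)) /eqP.
  by rewrite (_ : e0 0%N 0%N = 1) // (_ : entry _ _ _ 0 0%N 0%N = 0) // oner_eq0.
have Te0 : T e0 = e0.
  apply: blockseq_ext => -[|k] m; rewrite TE /rot_avg /=; last by rewrite !mulr0 addr0 mulr0.
  have eta00 : eta 0%N = 0 by exact: par_eta0.
  have -> : u 0%N = 1.
    by apply/eqP; rewrite -subr_eq0; apply/eqP/cabs_eq0; rewrite u_dist.
  by rewrite eta00 subr0 mulr0 addr0 !mul1r.
exists (blockseq R par_del par_len : completeNormedModType R[i]), T.
split; first by exists e0.
split.
  apply: (lipschitz_complex_continuous T 1) => x y; rewrite -linearB mul1r.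
  exact: avg_shift_norm_le u1 eta01 T TE (x - y).
split.
  exists 1 => n; apply: opnorm_le => x; apply: le_trans.
  exact: iter_avg_shift_norm_le u1 eta01 T TE n x.
have cabs_unit (z : R[i]) : `|z| = 1 -> cabs z = 1 by rewrite /cabs => ->.
split.
  apply/seteqP; split => [z [zT /cabs_unit z1]|_ ->] /=.
    have [//|zn1] := eqVneq z 1; exfalso; apply: zT.
    exact: resolvent_exists (lb z z1 zn1) (surj z z1 zn1).
  split; last exact: normr1.
  (* A left inverse of [1 - T] would send 0 both to [e0] and to 0. *)
  move=> [S [_ [Sl _]]]; move/eqP: e0_neq0; apply.
  by rewrite -(Sl e0) scale1r Te0 subrr -[RHS](Sl 0) scaler0 (linear0 T) subrr.
split.
  have [t0 t00 chord] := @chord_ge R.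
  (* One factor 1/2 in [4^-1] comes from the chord estimate, the other from the lower bound [lb]. *)
  exists ((5 + 3 * 1) * 4^-1 `^ (- alpha)), t0; split=> // t tt0 S.
  have t_gt0 : 0 < `|t| by case/andP: tt0.
  have ht := chord t tt0; have z1 := cabs_expi t.
  have zn1 : expi t != 1.
    by apply/eqP => z; move: ht; rewrite z subrr cabs0; lra.
  have C0 : 0 <= (5 + 3 * 1) * 4^-1 `^ (- alpha) * `|t| `^ (- alpha).
    by rewrite !mulr_ge0 ?powR_ge0 //; lra.
  apply: resolvent_opnorm_le C0 _ => x; apply: le_trans (lb _ z1 zn1 x) _.
  rewrite ler_wpM2r ?Re_norm_ge0 // -mulrA -powRM ?invr_ge0 //.
  apply: ler_wpM2l; first by lra.
  rewrite !powRN lef_pV2 ?posrE ?powR_gt0 //; try lra.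
  by apply: ge0_ler_powR; rewrite ?nnegrE; lra.
have [K K0 gr] := growth alpha halpha.
pose C : R := 1 + 3 * expR 1.
have C0 : 0 < C by rewrite ltr_wpDr // mulr_ge0 // expR_ge0.
(* The 4 combines [1 / (2 C)] from [opnorm_defect_ge] with [Im u >= eta / 2]. *)
apply: (limn_esup_gt0 _ (K / (4 * C))); first by rewrite divr_gt0 // mulr_gt0.
(* Block [m.+2] meets the condition [2 <= j], and its [n] is at least [m], so arbitrarily large [n]
   occur. *)
move=> m; have j2 : (2 <= m.+2)%N by [].
have [n jn [cle Kle]] := gr _ j2; exists n; first by apply: leq_trans jn; lia.
have e_gt0 : 0 < eta m.+2 by exact: par_eta_gt0.
have c0 : 0 <= n.+1%:R * eta m.+2 by rewrite mulr_ge0 // ltW.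
have [cL cN cC] := block_parameters R _ _ j2 c0 cle.
have L0 : (0 < m.+2 ^ 3)%N by rewrite expn_gt0.
have op_ge := opnorm_defect_ge _ _ _ _ _ u1 eta01 T TE m.+2 n _ C L0 C0 cL cN cC.
have Im_ge : eta m.+2 / (4 * C) <= `|complex.Im (u m.+2)| / (2 * C).
  have [_ _ uI] := uP m.+2.
  rewrite (_ : eta m.+2 / (4 * C) = eta m.+2 / 2 / (2 * C)); last first.
    by field; rewrite gt_eqF.
  by rewrite ler_pM2r ?invr_gt0 ?mulr_gt0 // (le_trans uI) // ler_norm.
apply: le_trans (ler_wpM2r (powR_ge0 _ _) (le_trans Im_ge op_ge)).
by rewrite mulrAC ler_wpM2r // invr_ge0 ltW // mulr_gt0.
Qed.
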